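(* For every integer $r\ge1$, the coefficient of $x$ in $P_{01r}(x)$ is negative and equals \[ 4^r \sum_{i=1}^r \left[{r \atop i}\right] \frac{B_i}{i} \Bigl(1-(-1)^i B_i \Bigr). \]
   Context: The Bernoulli numbers $B_n$ are defined by $\frac{z}{e^z-1}=\sum_{n\ge0}B_n\frac{z^n}{n!}$. For $m\ge0$, $s_m(x):=\frac{1}{m+1}\sum_{j=0}^m \binom{m+1}{j+1}(-1)^{m-j}B_{m-j}x^{j+1}$ (so $s_m(N)=1^m+\cdots+N^m$). $\left[{r \atop m}\right]$ is the unsigned Stirling number of the first kind, $x(x+1)\cdots(x+r-1)=\sum_m\left[{r \atop m}\right]x^m$. For $r\ge1$, $P_{01r}(x) := 4^r \sum_{m=0}^r (-1)^m \left[{r \atop m}\right] m! \sum_{1j_1+ \cdots + m j_{m} = m}\frac{1}{j_1! \cdots j_m!}\prod_{i=1}^{m}\left(\frac{(-1)^{i-1}B_{i}}{i \cdot i!}(s_{i}(x)-x) \right)^{j_{i}}$, the inner sum over tuples of nonnegative integers. (This polynomial satisfies $P_{01r}(N)=(-1)^N N!(-4)^r r!\,C_{01(N-r)}(N)$ for integers $N\ge r+1$, where $C_{01\ell}(N)$ is the coefficient of $(q-1)^{-\ell}$ in the partial fraction decomposition of $\prod_{j=1}^N(1-q^j)^{-1}$.) *)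

(* Defs.v *)
From mathcomp Require Import all_boot all_order all_algebra.
Set Implicit Arguments.
Unset Strict Implicit.
Unset Printing Implicit Defensive.
Import Order.TTheory GRing.Theory Num.Theory.
Local Open Scope ring_scope.

(* A formal power series over rat is its coefficient sequence nat -> rat. *)

Definition fps_mul (a b : nat -> rat) (n : nat) : rat :=
  \sum_(k < n.+1) a k * b (n - k)%N.

(* First n coefficients of 1 / a; meaningful when a 0 != 0. *)
Fixpoint fps_inv_seq (a : nat -> rat) (n : nat) : seq rat :=
  if n is p.+1 then
    let s := fps_inv_seq a p in
    rcons s (((p == 0%N)%:R - \sum_(k < p) a (p - k)%N * s`_k) / a 0%N)
  else [::].

Definition fps_inv (a : nat -> rat) (n : nat) : rat :=
  (fps_inv_seq a n.+1)`_n.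

(* e^z - 1 *)
Definition fps_expm1 (n : nat) : rat := (n`!%:R)^-1 - (n == 0%N)%:R.

(* z / (e^z - 1) is the inverse of (e^z - 1) / z, whose n-th coefficient is
   the (n+1)-st one of e^z - 1; see bernoulli_egf. In particular B_1 = -1/2. *)
Definition bernoulli (n : nat) : rat :=
  n`!%:R * fps_inv (fun k => fps_expm1 k.+1) n.

Lemma size_fps_inv_seq a n : size (fps_inv_seq a n) = n.
Proof. by elim: n => //= n IHn; rewrite size_rcons IHn. Qed.

Lemma nth_fps_inv_seq a n k : (k < n)%N -> (fps_inv_seq a n)`_k = fps_inv a k.
Proof.
elim: n => // n IHn; rewrite ltnS leq_eqVlt => /predU1P[-> // | lt_kn].
by rewrite /= nth_rcons size_fps_inv_seq lt_kn IHn.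
Qed.

Lemma fps_mulV a n : a 0%N != 0 -> fps_mul a (fps_inv a) n = (n == 0%N)%:R.
Proof.
move=> a0; rewrite /fps_mul big_ord_recl /= subn0 {1}/fps_inv /=.
rewrite nth_rcons size_fps_inv_seq ltnn eqxx mulrC divfK //.
rewrite (reindex_inj rev_ord_inj) /= -addrA [X in _ + X](_ : _ = 0) ?addr0 //.
apply/eqP; rewrite addrC subr_eq0; apply/eqP/eq_bigr => k _.
have kn : (n - k.+1 < n)%N by rewrite subnSK // leq_subr.
by rewrite nth_fps_inv_seq // subKn.
Qed.

Lemma bernoulli_egf n :
  fps_mul fps_expm1 (fun k => bernoulli k / k`!%:R) n = (n == 1%N)%:R.
Proof.
rewrite /fps_mul big_ord_recl /= {1}/fps_expm1 fact0 invr1 subrr mul0r add0r.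
case: n => [|n]; first by rewrite big_ord0.
rewrite eqSS -(@fps_mulV (fun k => fps_expm1 k.+1)) ?subr0 ?invr1 //.
apply: eq_bigr => k _; rewrite /= subSS /bernoulli [_`!%:R * _]mulrC mulfK //.
by rewrite pnatr_eq0 -lt0n fact_gt0.
Qed.

Definition s_poly (m : nat) : {poly rat} :=
  (m.+1%:R)^-1 *:
    \sum_(j < m.+1)
      ('C(m.+1, j.+1)%:R * (-1) ^+ (m - j) * bernoulli (m - j)) *: 'X^(j.+1).

(* Unsigned Stirling number of the first kind [r, m]. *)
Definition stirling1 (r m : nat) : rat :=
  (\prod_(k < r) ('X + k%:R%:P) : {poly rat})`_m.

(* The ordinal i : 'I_m stands for the index i + 1 in {1, ..., m}. A tuple of
   nonnegative integers with 1 j_1 + ... + m j_m = m has all its entries at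
   most m, so the inner sum ranges over functions into 'I_m.+1. *)
Definition P01 (r : nat) : {poly rat} :=
  4 ^+ r *:
    \sum_(m < r.+1)
      ((-1) ^+ m * stirling1 r m * m`!%:R) *:
        \sum_(j : {ffun 'I_m -> 'I_m.+1} | (\sum_(i < m) i.+1 * j i)%N == m)
          (\prod_(i < m) ((j i)`!)%:R)^-1 *:
            \prod_(i < m)
              (((-1) ^+ i * bernoulli i.+1 / (i.+1%:R * (i.+1)`!%:R)) *:
                 (s_poly i.+1 - 'X)) ^+ j i.

(* Main.v *)
From Stdlib Require Import BinInt.
Require Import Defs.
From mathcomp Require Import all_boot all_order all_algebra.
From mathcomp Require Import ring lra zify ssrZ.
Import Order.TTheory GRing.Theory Num.Theory.
Local Open Scope ring_scope.

(* Only the tuples with a single nonzero entry contribute to the linear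
   coefficient, so P_01r has linear coefficient 4^r sum_i [r, i] c_i with
   c_i = B_i / i (1 - (-1)^i B_i). For negativity, consider the shifted sums
   v_r(j) = sum_i [r, i] c_(i+j), which satisfy v_1(j) = c_(j+1) and
   v_(r+1)(j) = r v_r(j) + v_r(j+1). This recurrence is monotone, so once all the
   v_r(j) are nonpositive they remain so, and v_r(0) < 0 persists. Since c_i <= 0
   for all i > 12, upper bounds of c_1, ..., c_12 suffice to compute with, and all
   v_r(j) turn out to be nonpositive at r = 111, with v_r(0) < 0 for all r <= 111.
   That c_i <= 0 for i > 12 holds because B_i = 0 for odd i and
   |B_i| >= |B_14| = 7/6 for even i: Euler's recurrence
   (2n+1) b_n = sum_(0<k<n) b_k b_(n-k) for b_n = (-1)^(n-1) B_2n / (2n)! gives both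
   the signs and the growth of the Bernoulli numbers. *)

(** * Coefficients of z / (e^z - 1): differential equation and recurrence *)

Definition bernoulli_coef (n : nat) : rat := bernoulli n / n`!%:R.

Lemma bernoulliE n : bernoulli n = bernoulli_coef n * n`!%:R.
Proof. by rewrite divfK // pnatr_eq0 -lt0n fact_gt0. Qed.

(** Power series identities are used on truncations: equal low coefficients become a congruence
    modulo X^n with an explicit quotient. *)
Lemma drop_polyE (R : nzRingType) (p q : {poly R}) n :
  (forall i, (i < n)%N -> p`_i = q`_i) -> p = q + drop_poly n (p - q) * 'X^n.
Proof.
move=> pq; apply/polyP => i; rewrite coefD coefMXn coef_drop_poly coefB.
by case: ltnP => [/pq->|/subnK->]; rewrite ?addr0 // addrC subrK.
Qed.

(* The power series f = z / (e^z - 1) satisfies z f' = f - f^2 - z f. The proof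
   multiplies by E = e^z - 1, using E f = z, E' = E + 1 and E' f + E f' = 1, all
   modulo a power of z. *)
Lemma bernoulli_coef_ode n :
  n.+1%:R * bernoulli_coef n.+1 = bernoulli_coef n.+1
    - fps_mul bernoulli_coef bernoulli_coef n.+1 - bernoulli_coef n.
Proof.
(* Differentiating loses one power of X and cancelling the zero of [E] another, so X^(n+2) still
   divides [D], which covers coefficient n+1. *)
pose N := n.+4; pose M := n.+3.
pose f := \poly_(i < N) bernoulli_coef i; pose E := \poly_(i < N) fps_expm1 i.
pose D := 'X * f^`() - f + f * f + 'X * f.
suff D0 : D`_n.+1 = 0.
  move: D0; rewrite /D !coefD coefN !coefXM coef_deriv !coef_poly coefM /=.
  rewrite /N !ifT; try lia.
  rewrite (_ : \sum_(_ < _) _ = fps_mul bernoulli_coef bernoulli_coef n.+1).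
    by rewrite mulr_natl => D0; lra.
  apply: eq_bigr => -[k kn] _; rewrite !coef_poly /= !ifT //; lia.
have [h1 fE] : exists h, E * f = 'X + h * 'X^N.
  exists (drop_poly N (E * f - 'X)); apply: drop_polyE => i iN.
  rewrite coefX -bernoulli_egf coefM; apply: eq_bigr => -[k ki] _ /=.
  rewrite !coef_poly !ifT //; lia.
have [h2 E'] : exists h, E^`() = E + 1 + h * 'X^M.
  exists (drop_poly M (E^`() - (E + 1))); apply: drop_polyE => i iM.
  rewrite coef_deriv coefD coef1 !coef_poly !ifT; try lia.
  rewrite /fps_expm1 /= subr0 subrK factS natrM -[LHS]mulr_natl invfM mulrA divff ?mul1r //.
  by rewrite pnatr_eq0.
have E'f : E^`() * f + E * f^`() = 1 + (h1^`() * 'X + h1 *+ N) * 'X^M.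
  rewrite -derivM fE derivD derivX derivM derivXn (exprS _ M : 'X^N = _) -[N.-1]/M.
  by rewrite mulrDl !mulrnAr !mulrnAl mulrA.
have divED : 'X^M %| E * D.
  (* The quotient collects the error terms; the main terms X(1 - X - f) - X + X f + X^2 cancel. *)
  apply/dvdpP; exists ('X * (h1^`() * 'X + h1 *+ N - h2 * f - h1 + h1 * f)).
  have -> : E * D = 'X * (E * f^`()) - E * f + (E * f) * f + 'X * (E * f) by rewrite /D; ring.
  have -> : E * f^`() = 1 + (h1^`() * 'X + h1 *+ N) * 'X^M - (E * f + f + h2 * 'X^M * f).
    by apply/eqP; rewrite eq_sym subr_eq -E'f E'; apply/eqP; ring.
  rewrite fE /N exprS -/M; ring.
have [U EU U0] : exists2 U, E = 'X * U & U`_0 = 1.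
  exists (\poly_(i < n.+3) fps_expm1 i.+1); last by rewrite coef_poly /fps_expm1 /= subr0 invr1.
  by apply/polyP => -[|i]; rewrite coefXM !coef_poly //=.
have : 'X^(n.+2) %| D.
  rewrite -(@Gauss_dvdpr _ _ U); last first.
    by apply: coprimep_expl; rewrite coprimep_sym coprimepX /root horner_coef0 U0.
  rewrite -(@dvdp_mul2l _ 'X) ?polyX_eq0 // mulrA -EU -exprS //.
by case/dvdpP => q ->; rewrite coefMXn ltnSn.
Qed.

Lemma bernoulli_coef0 : bernoulli_coef 0 = 1.
Proof.
by rewrite /bernoulli_coef /bernoulli /fps_inv /= big_ord0 /fps_expm1 /= !subr0 !fact0.
Qed.

Lemma bernoulli_coef1 : bernoulli_coef 1 = - 1 / 2.
Proof.
have := bernoulli_coef_ode 0; rewrite /fps_mul !big_ord_recr big_ord0 /=.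
by rewrite bernoulli_coef0 => H; lra.
Qed.

(** The terms of the square with an index 0 or 1 contribute 2 b_(n+3) - b_(n+2), since b_1 = -1/2,
    so b_(n+2) cancels. *)
Lemma bernoulli_coef_rec n :
  (n.+4)%:R * bernoulli_coef n.+3 =
  - \sum_(k < n) bernoulli_coef k.+2 * bernoulli_coef (n.+1 - k).
Proof.
have := bernoulli_coef_ode n.+2; rewrite /fps_mul.
rewrite big_ord_recl big_ord_recl !big_ord_recr /= !subnn /bump /=.
under eq_bigr => k _ do rewrite !add1n !subSS.
rewrite !add1n subn0 !subSS subn0 subSnn bernoulli_coef0 bernoulli_coef1.
by move: (\sum_(_ < _) _) => S H; rewrite (mulrS 1 n.+3); lra.
Qed.

Lemma bernoulli_coef2 : bernoulli_coef 2 = 1 / 12.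
Proof.
have := bernoulli_coef_ode 1; rewrite /fps_mul !big_ord_recr big_ord0 /=.
by rewrite bernoulli_coef0 bernoulli_coef1 => H; lra.
Qed.

(** The two indices in each product of the recurrence sum to 2p+3, so one of them is odd, at least 3
    and smaller: strong induction applies. *)
Lemma bernoulli_coef_odd p : bernoulli_coef p.*2.+3 = 0.
Proof.
elim/ltn_ind: p => p IHp.
have : p.*2.+4%:R * bernoulli_coef p.*2.+3 = 0.
  rewrite bernoulli_coef_rec big1 ?oppr0 // => -[k kp] _ /=.
  have [ok|ek] := boolP (odd k).
    have -> : k.+2 = (k./2).*2.+3 by lia.
    rewrite IHp ?mul0r //; lia.
  have -> : (p.*2.+1 - k = (p.-1 - k./2).*2.+3)%N by lia.
  rewrite IHp ?mulr0 //; lia.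
by move/eqP; rewrite mulf_eq0 pnatr_eq0 => /eqP.
Qed.

Lemma sum_even_terms (V : zmodType) (F : nat -> V) n :
  (forall k, odd k -> F k = 0) -> \sum_(k < n.*2.+1) F k = \sum_(k < n.+1) F k.*2.
Proof.
move=> F0; elim: n => [|n IHn]; first by rewrite !big_ord1.
rewrite doubleS 2!big_ord_recr IHn [RHS]big_ord_recr /= F0 ?addr0 //.
by rewrite /= odd_double.
Qed.

(** * Even-index Bernoulli numbers: signs and growth *)

(** This is b_(p+1) of Euler's recurrence; positivity, shown below, makes it |B_(2p+2)| /
    (2p+2)!. *)
Definition abs_bernoulli_coef (p : nat) : rat := (-1) ^+ p * bernoulli_coef p.*2.+2.

Lemma bernoulli_coef_even p : bernoulli_coef p.*2.+2 = (-1) ^+ p * abs_bernoulli_coef p.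
Proof. by rewrite mulrA -expr2 sqrr_sign mul1r. Qed.

(** Terms with odd indices vanish, and (-1)^p = (-1)^k (-1)^(p-k) gives all the others the same
    sign. *)
Lemma abs_bernoulli_coef_rec p :
  (p.*2 + 5)%:R * abs_bernoulli_coef p.+1 =
  \sum_(k < p.+1) abs_bernoulli_coef k * abs_bernoulli_coef (p - k).
Proof.
rewrite /abs_bernoulli_coef addnC doubleS mulrCA bernoulli_coef_rec.
rewrite (@sum_even_terms _ (fun k =>
  bernoulli_coef k.+2 * bernoulli_coef (p.*2.+2 - k))); last first.
  move=> k ok; rewrite (_ : k.+2 = (k./2).*2.+3); last by lia.
  by rewrite bernoulli_coef_odd mul0r.
rewrite mulrN exprS mulN1r mulNr opprK mulr_sumr; apply: eq_bigr => -[k kp] _ /=.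
have -> : (p.*2.+2 - k.*2 = (p - k).*2.+2)%N by lia.
by rewrite -{1}(subnK (kp : k <= p)%N) exprD; ring.
Qed.

Lemma abs_bernoulli_coef0 : abs_bernoulli_coef 0 = 1 / 12.
Proof. by rewrite /abs_bernoulli_coef bernoulli_coef2 mul1r. Qed.

Lemma abs_bernoulli_coef_gt0 p : 0 < abs_bernoulli_coef p.
Proof.
elim/ltn_ind: p => -[_|p IHp]; first by rewrite abs_bernoulli_coef0 divr_gt0.
have D0 : 0 < (p.*2 + 5)%:R :> rat by rewrite ltr0n addnS.
rewrite -(pmulr_rgt0 _ D0) abs_bernoulli_coef_rec.
rewrite big_ord_recl ltr_pwDl ?sumr_ge0 // => [|k _]; last first.
  by rewrite mulr_ge0 // ltW // IHp // ?ltn_ord ?ltnS ?leq_subr // ltn_ord.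
by rewrite mulr_gt0 // IHp // ltnS leq_subr.
Qed.

(** Of the positive terms in Euler's recurrence keep only the first and the last, each 1/12 of the
    preceding coefficient. *)
Lemma abs_bernoulli_coef_growth p :
  abs_bernoulli_coef p.+1 / (6 * (p.*2 + 7)%:R) <= abs_bernoulli_coef p.+2.
Proof.
have D0 : 0 < (p.*2 + 7)%:R :> rat by rewrite ltr0n addnS.
have := abs_bernoulli_coef_rec p.+1.
rewrite big_ord_recl big_ord_recr /= subnn subn0 abs_bernoulli_coef0.
rewrite ler_pdivrMr ?mulr_gt0 // (_ : (p.+1.*2 + 5 = p.*2 + 7)%N); last by lia.
set S := \sum_(_ < _) _; have : 0 <= S.
  by rewrite sumr_ge0 // => k _; rewrite mulr_ge0 // ltW // abs_bernoulli_coef_gt0.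
by rewrite /bump /=; lra.
Qed.

Definition abs_bernoulli (p : nat) : rat := abs_bernoulli_coef p * (p.*2.+2)`!%:R.

Lemma bernoulli_even p : bernoulli p.*2.+2 = (-1) ^+ p * abs_bernoulli p.
Proof. by rewrite bernoulliE bernoulli_coef_even -mulrA. Qed.

Lemma abs_bernoulli_gt0 p : 0 < abs_bernoulli p.
Proof. by rewrite mulr_gt0 ?abs_bernoulli_coef_gt0 // ltr0n fact_gt0. Qed.

Lemma fact_double_S p :
  (p.+1.*2.+2)`!%:R = (p.*2.+4 * p.*2.+3)%:R * (p.*2.+2)`!%:R :> rat.
Proof. by rewrite -natrM -mulnA -!factS doubleS. Qed.

(** The ratio is at least (2p+6)(2p+5) / (6(2p+7)), which exceeds 1 here. *)
Lemma abs_bernoulli_le p :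
  (5 <= p)%N -> abs_bernoulli p.+1 <= abs_bernoulli p.+2.
Proof.
move=> p5; rewrite /abs_bernoulli (fact_double_S p.+1) [leRHS]mulrA.
rewrite ler_pM2r ?ltr0n ?fact_gt0 //.
rewrite (le_trans _ (ler_wpM2r _ (abs_bernoulli_coef_growth p))) ?ler0n //.
rewrite mulrAC ler_pdivlMr ?mulr_gt0 ?ltr0n ?addnS //.
by rewrite ler_pM2l ?abs_bernoulli_coef_gt0 // -natrM ler_nat; nia.
Qed.

(** * The linear coefficient of P_01r *)

(** Each factor is divisible by X, so the product is divisible by X^2. *)
Lemma coef1_prod_exp (I : finType) (p : I -> {poly rat}) (k : I -> nat) :
  (forall i, (p i)`_0 = 0) -> (1 < \sum_i k i)%N -> (\prod_i p i ^+ k i)`_1 = 0.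
Proof.
move=> p0 k2.
have pE i : exists q, p i = q * 'X.
  by exists (p i %/ 'X)%R; rewrite divpK // -['X]subr0 -polyC0 dvdp_XsubCl /root horner_coef0 p0.
have [q qE] := fin_all_exists pE.
under eq_bigr => i _ do rewrite qE exprMn.
by rewrite big_split /= prodrXr coefMXn k2.
Qed.

(** A surviving tuple has entries of total at most 1; weight m+1 then forces the single 1 into the
    last position, which is the tuple [d]. *)
Lemma coef1_partition_sum (p : nat -> {poly rat}) m :
  (forall i, (p i)`_0 = 0) ->
  (\sum_(j : {ffun 'I_m.+1 -> 'I_m.+2} | (\sum_(i < m.+1) i.+1 * j i)%N == m.+1)
     (\prod_(i < m.+1) ((j i)`!)%:R)^-1 *: \prod_(i < m.+1) p i ^+ j i)`_1
  = (p m)`_1.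
Proof.
move=> p0; pose d : {ffun 'I_m.+1 -> 'I_m.+2} := [ffun i => inord (i == ord_max)].
have dE i : d i = (i == ord_max) :> nat.
  by rewrite ffunE inordK //; case: (i == _).
have d_max : d ord_max = 1%N :> nat by rewrite dE eqxx.
have d_widen (i : 'I_m) : d (widen_ord (leqnSn m) i) = 0%N :> nat.
  by rewrite dE -val_eqE /= ltn_eqF.
rewrite coef_sum (bigD1 d) /=; last first.
  by rewrite big_ord_recr /= d_max muln1 big1 // => i _; rewrite d_widen muln0.
rewrite [X in _ + X]big1 ?addr0.
  rewrite coefZ !big_ord_recr /= d_max !big1 => [|i _|i _]; rewrite ?d_widen //.
  by rewrite mul1r invr1 !mul1r.
move=> j /andP[/eqP wj jd]; rewrite coefZ coef1_prod_exp ?mulr0 //.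
rewrite ltnNge; apply: contra_neqN jd => j1.
have [i ji]: exists i, (0 < j i)%N.
  apply/existsP; apply: contra_eqT wj; rewrite negb_exists => /forallP j0.
  by rewrite big1 // => i _; have := j0 i; rewrite -eqn0Ngt => /eqP->; rewrite muln0.
move: j1; rewrite (bigD1 i) //= => j1.
have ji1 : j i = 1%N :> nat.
  by apply/eqP; rewrite eqn_leq ji andbT (leq_trans _ j1) // leq_addr.
have j0 k : k != i -> j k = 0%N :> nat.
  move=> ki; move: j1; rewrite ji1 -[X in (_ <= X)%N]addn0 leq_add2l leqn0.
  by rewrite sum_nat_eq0 => /forallP/(_ k); rewrite ki => /eqP.
have /eqP iE : i == ord_max.
  move: wj; rewrite (bigD1 i) //= ji1 muln1 big1 => [|k ki]; last by rewrite j0 ?muln0.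
  by rewrite addn0 -val_eqE /= => -[->].
apply/ffunP => k; apply/val_inj; rewrite /= dE -iE.
by case: eqVneq => [->|/j0].
Qed.

Lemma coef0_s_poly m : (s_poly m)`_0 = 0.
Proof.
by rewrite coefZ coef_sum big1 ?mulr0 // => j _; rewrite coefZ coefXn mulr0.
Qed.

Lemma coef1_s_poly m : (s_poly m)`_1 = (-1) ^+ m * bernoulli m.
Proof.
rewrite coefZ coef_sum big_ord_recl big1 => [|j _]; last first.
  by rewrite coefZ coefXn /= mulr0.
rewrite coefZ coefXn /= bin1 subn0 mulr1 addr0 -!mulrA mulKf //.
by rewrite pnatr_eq0.
Qed.

(** The c_i of the overview; division by zero gives c_0 = 0, so sums may start at 0. *)
Definition lin_weight (i : nat) : rat :=
  bernoulli i / i%:R * (1 - (-1) ^+ i * bernoulli i).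

(** In the surviving term m! cancels, and (-1)^m (-1)^(m-1) = -1 turns (-1)^m B_m - 1 into 1 -
    (-1)^m B_m. *)
Lemma coef1_P01 r :
  (P01 r)`_1 = 4 ^+ r * \sum_(i < r.+1) stirling1 r i * lin_weight i.
Proof.
rewrite coefZ coef_sum; congr (_ * _); apply: eq_bigr => -[[|m] _] _ /=.
  rewrite coefZ coef_sum big1 => [|j _].
    by rewrite /lin_weight invr0 !(mulr0, mul0r).
  by rewrite coefZ !big_ord0 coef1 mulr0.
rewrite coefZ (@coef1_partition_sum (fun i =>
  ((-1) ^+ i * bernoulli i.+1 / (i.+1%:R * (i.+1)`!%:R)) *: (s_poly i.+1 - 'X))).
  rewrite coefZ coefB coef1_s_poly coefX /= /lin_weight exprS.
  have s2 : (-1) ^+ m * (-1) ^+ m = 1 :> rat by rewrite -expr2 sqrr_sign.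
  have m0 : m.+1%:R != 0 :> rat by rewrite pnatr_eq0.
  have f0 : (m.+1)`!%:R != 0 :> rat by rewrite pnatr_eq0 -lt0n fact_gt0.
  move: s2 m0 f0; move: (m.+1%:R) ((m.+1)`!%:R) ((-1) ^+ m) => M F e s2 M0 F0.
  transitivity (- (e * e) * stirling1 r m.+1 * (bernoulli m.+1 / M) *
     (-1 * e * bernoulli m.+1 - 1)); first by field; rewrite M0 F0.
  by rewrite s2; ring.
by move=> i; rewrite coefZ coefB coef0_s_poly coefX subr0 mulr0.
Qed.

(** * Stirling numbers and the shifted sums v_r(j) *)

Lemma stirling1_S r i :
  stirling1 r.+1 i = r%:R * stirling1 r i + (if i is i'.+1 then stirling1 r i' else 0).
Proof.
rewrite /stirling1 big_ord_recr /= mulrDr coefD coefMX coefMC addrC mulrC.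
by case: i.
Qed.

Lemma stirling1_gt r i : (r < i)%N -> stirling1 r i = 0.
Proof.
elim: r i => [|r IHr] [|i] //; first by rewrite /stirling1 big_ord0 coef1.
by move=> ri; rewrite stirling1_S !IHr ?mulr0 ?addr0 // ltnW.
Qed.

Definition stirling_shift_sum (c : nat -> rat) (r j : nat) : rat :=
  \sum_(i < r.+1) stirling1 r i * c (i + j)%N.

(** In the new factor X + r of the rising factorial, X shifts the weights by one. *)
Lemma stirling_shift_sum_S c r j :
  stirling_shift_sum c r.+1 j =
  r%:R * stirling_shift_sum c r j + stirling_shift_sum c r j.+1.
Proof.
rewrite /stirling_shift_sum.
under eq_bigr => i _ do rewrite stirling1_S mulrDl -mulrA.
rewrite big_split -mulr_sumr big_ord_recr /= stirling1_gt // mul0r addr0.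
rewrite [X in _ + X]big_ord_recl /= mul0r add0r.
by under [X in _ + X = _]eq_bigr => i _ do rewrite /bump add1n addSnnS.
Qed.

Lemma stirling_shift_sum1 c j : stirling_shift_sum c 1 j = c j.+1.
Proof.
rewrite /stirling_shift_sum !big_ord_recl big_ord0 /= /stirling1.
by rewrite !big_ord_recl !big_ord0 !mulr1 !coefD !coefX !coefC /= !(mul0r, add0r, addr0, mul1r).
Qed.

(** * Values and signs of the weights *)

Lemma abs_bernoulli_values :
  [/\ abs_bernoulli 0 = 1 / 6, abs_bernoulli 1 = 1 / 30, abs_bernoulli 2 = 1 / 42,
      abs_bernoulli 3 = 1 / 30 & abs_bernoulli 4 = 5 / 66] /\
  abs_bernoulli 5 = 691 / 2730 /\ abs_bernoulli 6 = 7 / 6.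
Proof.
(* With [b] and [f] abstract, simplification cannot unfold factorials or power series; only the
   recurrences are used. *)
suff values (b f : nat -> rat) : b 0 = 1 / 12 ->
    (forall p, (p.*2 + 5)%:R * b p.+1 = \sum_(k < p.+1) b k * b (p - k)%N) ->
    f 0 = 2 -> (forall p, f p.+1 = (p.*2.+4 * p.*2.+3)%:R * f p) ->
    [/\ b 0 * f 0 = 1 / 6, b 1 * f 1 = 1 / 30, b 2 * f 2 = 1 / 42,
      b 3 * f 3 = 1 / 30 & b 4 * f 4 = 5 / 66] /\
    b 5 * f 5 = 691 / 2730 /\ b 6 * f 6 = 7 / 6.
  exact: (values abs_bernoulli_coef (fun p => (p.*2.+2)`!%:R) abs_bernoulli_coef0
    abs_bernoulli_coef_rec erefl fact_double_S).
move=> b0 bS f0 fS.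
have f1 : f 1 = 24 by rewrite fS f0 natrM !(doubleS, double0); lra.
have f2 : f 2 = 720 by rewrite fS f1 natrM !(doubleS, double0); lra.
have f3 : f 3 = 56 * 720 by rewrite fS f2 natrM !(doubleS, double0); lra.
have f4 : f 4 = 90 * 56 * 720 by rewrite fS f3 natrM !(doubleS, double0); lra.
have f5 : f 5 = 132 * 90 * 56 * 720 by rewrite fS f4 natrM !(doubleS, double0); lra.
have f6 : f 6 = 182 * 132 * 90 * 56 * 720 by rewrite fS f5 natrM !(doubleS, double0); lra.
have b1 : b 1 = 1 / 30 / 24.
  by have := bS 0; rewrite !big_ord_recr big_ord0 /=
    !(subSS, subn0, doubleS, double0) b0; lra.
have b2 : b 2 = 1 / 42 / 720.
  by have := bS 1; rewrite !big_ord_recr big_ord0 /=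
    !(subSS, subn0, doubleS, double0) b0 b1; lra.
have b3 : b 3 = 1 / 30 / 720 / 56.
  by have := bS 2; rewrite !big_ord_recr big_ord0 /=
    !(subSS, subn0, doubleS, double0) b0 b1 b2; lra.
have b4 : b 4 = 5 / 66 / 720 / 56 / 90.
  by have := bS 3; rewrite !big_ord_recr big_ord0 /=
    !(subSS, subn0, doubleS, double0) b0 b1 b2 b3; lra.
have b5 : b 5 = 691 / 2730 / 720 / 56 / 90 / 132.
  by have := bS 4; rewrite !big_ord_recr big_ord0 /=
    !(subSS, subn0, doubleS, double0) b0 b1 b2 b3 b4; lra.
have b6 : b 6 = 7 / 6 / 720 / 56 / 90 / 132 / 182.
  by have := bS 5; rewrite !big_ord_recr big_ord0 /=
    !(subSS, subn0, doubleS, double0) b0 b1 b2 b3 b4 b5; lra.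
rewrite f0 f1 f2 f3 f4 f5 f6 b0 b1 b2 b3 b4 b5 b6.
by clear; split; [split | split]; lra.
Qed.

Lemma lin_weight_even p :
  lin_weight p.*2.+2 =
  ((-1) ^+ p * abs_bernoulli p - abs_bernoulli p ^+ 2) / p.*2.+2%:R.
Proof.
rewrite /lin_weight bernoulli_even -[(-1) ^+ _.+2]signr_odd -doubleS odd_double expr0.
have : (-1) ^+ p * (-1) ^+ p = 1 :> rat by rewrite -expr2 sqrr_sign.
move: ((-1) ^+ p) (abs_bernoulli p) (p.*2.+2%:R^-1) => e a M e2.
by transitivity ((e * a - (e * e) * a ^+ 2) * M); [ring | rewrite e2 mul1r].
Qed.

Lemma lin_weight_odd p : lin_weight p.*2.+3 = 0.
Proof. by rewrite /lin_weight bernoulliE bernoulli_coef_odd !mul0r. Qed.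

Lemma lin_weight0 : lin_weight 0 = 0.
Proof. by rewrite /lin_weight invr0 mulr0 mul0r. Qed.

Lemma lin_weight1 : lin_weight 1 = - 1 / 4.
Proof. by rewrite /lin_weight bernoulliE bernoulli_coef1 expr1 factS fact0; lra. Qed.

(** For even i and a = |B_i| the numerator is at most a - a^2, and a >= 1 follows by monotonicity
    from |B_14| = 7/6. *)
Lemma lin_weight_le0 i : (13 <= i)%N -> lin_weight i <= 0.
Proof.
move=> i13; have [oi|ei] := boolP (odd i).
  by rewrite (_ : i = (i./2.-1).*2.+3) ?lin_weight_odd //; lia.
rewrite (_ : i = (i./2.-1).*2.+2) ?lin_weight_even; last by lia.
have : (6 <= i./2.-1)%N by lia.
move: (i./2.-1) => p p6; rewrite pmulr_lle0 ?invr_gt0 ?ltr0n // subr_le0.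
have a1 : 1 <= abs_bernoulli p.
  rewrite -(subnK p6); elim: (p - 6)%N => [|n IHn].
    by have [_ [_ ->]] := abs_bernoulli_values; lra.
  by rewrite addSn (le_trans IHn) // !addnS abs_bernoulli_le // addnS.
apply: (@le_trans _ _ (abs_bernoulli p)).
  by rewrite -signr_odd; case: (odd p); rewrite ?mul1r // mulN1r; lra.
by rewrite expr2 ler_peMl // ltW // abs_bernoulli_gt0.
Qed.

(** * Numerical bounds for the shifted sums *)

(** The bounds are iterated in binary integers, on which [vm_compute] is efficient, and then
    embedded in the rationals. *)
Definition rat_of_Z (z : Z) : rat := (int_of_Z z)%:~R.

Lemma rat_of_Zpos p : rat_of_Z (Zpos p) = (Pos.to_nat p)%:R.
Proof. by []. Qed.

Lemma rat_of_Zneg p : rat_of_Z (Zneg p) = - (Pos.to_nat p)%:R.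
Proof. by rewrite -[Zneg p]/(- Zpos p) /rat_of_Z !rmorphN. Qed.

Lemma rat_of_Z0 : rat_of_Z Z0 = 0.
Proof. by []. Qed.

Lemma rat_of_Z_lt0 z : Z.ltb z Z0 -> rat_of_Z z < 0.
Proof. by case: z => // p _; rewrite /rat_of_Z ltrz0. Qed.

Lemma rat_of_Z_le0 z : Z.leb z Z0 -> rat_of_Z z <= 0.
Proof. by case: z => // p _; rewrite /rat_of_Z lerz0. Qed.

(* The initial entries are upper bounds, in units of 10^-4, of the weights of
   index 1, ..., 12; all later weights are nonpositive. *)
Fixpoint weight_bounds (n : nat) : seq Z :=
  if n is m.+1 then
    let w := weight_bounds m in
    mkseq (fun j => n%:R * w`_j + w`_j.+1) 12
  else [:: Zneg 2500; Zpos 695; Z0; Zneg 86; Z0; Zpos 39; Z0; Zneg 43; Z0; Zpos 71; Z0; Zneg 264].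

Lemma size_weight_bounds n : size (weight_bounds n) = 12.
Proof. by case: n => // n; rewrite size_mkseq. Qed.

Lemma lin_weight_le j :
  lin_weight j.+1 <= rat_of_Z (weight_bounds 0)`_j / (100 * 100).
Proof.
have [[v0 v1 v2 v3 v4] [v5 _]] := abs_bernoulli_values.
case: j => [|[|[|[|[|[|[|[|[|[|[|[|j]]]]]]]]]]]]; rewrite [nth _ _ _]/=.
- by rewrite lin_weight1 rat_of_Zneg (_ : Pos.to_nat 2500 = 2500)%N; [clear; lra | lia].
- by rewrite (lin_weight_even 0) v0 !(doubleS, double0)
    rat_of_Zpos (_ : Pos.to_nat 695 = 695)%N; [clear; lra | lia].
- by rewrite (lin_weight_odd 0) rat_of_Z0; clear; lra.
- by rewrite (lin_weight_even 1) v1 !(doubleS, double0)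
    rat_of_Zneg (_ : Pos.to_nat 86 = 86)%N; [clear; lra | lia].
- by rewrite (lin_weight_odd 1) rat_of_Z0; clear; lra.
- by rewrite (lin_weight_even 2) v2 !(doubleS, double0)
    rat_of_Zpos (_ : Pos.to_nat 39 = 39)%N; [clear; lra | lia].
- by rewrite (lin_weight_odd 2) rat_of_Z0; clear; lra.
- by rewrite (lin_weight_even 3) v3 !(doubleS, double0)
    rat_of_Zneg (_ : Pos.to_nat 43 = 43)%N; [clear; lra | lia].
- by rewrite (lin_weight_odd 3) rat_of_Z0; clear; lra.
- by rewrite (lin_weight_even 4) v4 !(doubleS, double0)
    rat_of_Zpos (_ : Pos.to_nat 71 = 71)%N; [clear; lra | lia].
- by rewrite (lin_weight_odd 4) rat_of_Z0; clear; lra.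
- by rewrite (lin_weight_even 5) v5 !(doubleS, double0)
    rat_of_Zneg (_ : Pos.to_nat 264 = 264)%N; [clear; lra | lia].
(* The index is at least 13, and the default entry 0 past the end of the list is the bound. *)
- by rewrite nth_nil rat_of_Z0; apply: le_trans (lin_weight_le0 _ _) _; [lia | clear; lra].
Qed.

(** The recurrence has nonnegative coefficients, so upper bounds propagate. The list starts at r =
    1, hence the shift between n and n+1. *)
Lemma stirling_shift_sum_le n j :
  stirling_shift_sum lin_weight n.+1 j <= rat_of_Z (weight_bounds n)`_j / (100 * 100).
Proof.
elim: n j => [|n IHn] j; first by rewrite stirling_shift_sum1 lin_weight_le.
rewrite stirling_shift_sum_S.
have -> : rat_of_Z (weight_bounds n.+1)`_j =
    n.+1%:R * rat_of_Z (weight_bounds n)`_j + rat_of_Z (weight_bounds n)`_j.+1.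
  have [j12|j12] := leqP 12 j.
    rewrite !nth_default ?size_weight_bounds // ?mulr0 //; first by lia.
  by rewrite /= nth_mkseq // /rat_of_Z !rmorphD !rmorphM !rmorph_nat.
by rewrite mulrDl -mulrA lerD // ler_wpM2l.
Qed.

Lemma stirling_shift_sum_tail n :
  stirling_shift_sum lin_weight (n + 111) 0 < 0 /\
  forall j, stirling_shift_sum lin_weight (n + 111) j <= 0.
Proof.
elim: n => [|n [IH0 IHn]].
  have w_lt0 : Z.ltb (weight_bounds 110)`_0 Z0 by vm_compute.
  have w_le0 : all (fun z => Z.leb z Z0) (weight_bounds 110) by vm_compute.
  (* Only the signs of the bounds for r = 111 matter from here on, so the list is made opaque. *)
  move: (weight_bounds 110) (stirling_shift_sum_le 110) w_lt0 w_le0 => w le_w w_lt0 w_le0.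
  have D0 : 0 < (100 * 100)^-1 :> rat by clear; lra.
  split=> [|j].
    by apply: le_lt_trans (le_w 0) _; rewrite (pmulr_llt0 _ D0) rat_of_Z_lt0.
  apply: le_trans (le_w j) _; rewrite (pmulr_lle0 _ D0); apply: rat_of_Z_le0.
  have [j_ge|j_lt] := leqP (size w) j; first by rewrite nth_default.
  exact: (allP w_le0) (mem_nth _ _).
rewrite addSn; split=> [|j]; rewrite stirling_shift_sum_S.
  by rewrite ltr_wnDr // nmulr_llt0 // ltr0n addnS.
by rewrite ler_wnDr // mulr_ge0_le0 // ler0n.
Qed.

Lemma stirling_shift_sum_lt0 r : (0 < r)%N -> stirling_shift_sum lin_weight r 0 < 0.
Proof.
case: r => // n _; have [n110|n110] := ltnP n 110; last first.
  by rewrite -(subnK (n110 : 110 < n.+1)%N); case: (stirling_shift_sum_tail (n.+1 - 111)).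
have D0 : 0 < (100 * 100)^-1 :> rat by lra.
apply: le_lt_trans (stirling_shift_sum_le n _) _; rewrite (pmulr_llt0 _ D0).
(* The cases r = 1, ..., 110 are checked by computing the first entry of each list. *)
apply: rat_of_Z_lt0; have : n \in iota 0 110 by rewrite mem_iota.
by move: n {n110}; apply/allP; vm_compute.
Qed.

Theorem theorem7p4 (r : nat) (hr : (1 <= r)%N) :
  (P01 r)`_1 < 0 /\
  (P01 r)`_1 =
    4 ^+ r * \sum_(1 <= i < r.+1)
      stirling1 r i * (bernoulli i / i%:R) * (1 - (-1) ^+ i * bernoulli i).
Proof.
split; rewrite coef1_P01.
  rewrite pmulr_rlt0 ?exprn_gt0 //.
  rewrite (_ : \sum_(_ < _) _ = stirling_shift_sum lin_weight r 0).
    exact: stirling_shift_sum_lt0.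
  by apply: eq_bigr => i _; rewrite addn0.
rewrite big_ord_recl lin_weight0 mulr0 add0r big_add1 big_mkord.
by congr (_ * _); apply: eq_bigr => i _; rewrite /lin_weight mulrA.
Qed.
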